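(* Let $\alpha,\beta,\gamma,\delta\in\mathbb{R}$ with $\alpha+\delta\neq 0$ and $\alpha\gamma=0$, and let $(G_7,g,J)$ be the connected, simply connected three-dimensional Lorentzian Lie group with product structure $J$ whose Lie algebra $\mathfrak{g}$ has a pseudo-orthonormal basis $\{e_1,e_2,e_3\}$ ($e_3$ timelike) with $[e_1,e_2]=-\alpha e_1-\beta e_2-\beta e_3$, $[e_1,e_3]=\alpha e_1+\beta e_2+\beta e_3$, $[e_2,e_3]=\gamma e_1+\delta e_2+\delta e_3$. Let $c\in\mathbb{R}$. Then $(G_7,g,J)$ is a second kind algebraic Ricci soliton associated to the canonical connection $\nabla^0$ with constant $c$ if and only if one of the following holds: (i) $\alpha=\gamma=c=0$, $\delta\neq 0$; in particular, $D=0$; (ii) $\alpha\neq 0$, $\beta=\gamma=0$, $\frac{\alpha^2}{2}+c=0$, $\alpha+\delta\neq 0$; in particular, $De_1=-\frac{\alpha^2}{2}e_1$, $De_2=-\frac{\alpha^2}{2}e_2-\frac{\alpha^2}{2}e_3$, $De_3=\frac{\alpha^2}{2}e_2+\frac{\alpha^2}{2}e_3$.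
   Context: The left-invariant Lorentzian metric $g$ satisfies $g(e_1,e_1)=g(e_2,e_2)=1$, $g(e_3,e_3)=-1$, $g(e_i,e_j)=0$ for $i\ne j$. All tensors and connections are left-invariant and evaluated on $\mathfrak{g}$. $\nabla$ is the Levi-Civita connection of $g$. The product structure is $Je_1=e_1$, $Je_2=e_2$, $Je_3=-e_3$, and $(\nabla_XJ)Y=\nabla_X(JY)-J(\nabla_XY)$. The canonical connection is $\nabla^0_XY=\nabla_XY-\frac12(\nabla_XJ)(JY)$, with curvature $R^0(X,Y)Z=\nabla^0_X\nabla^0_YZ-\nabla^0_Y\nabla^0_XZ-\nabla^0_{[X,Y]}Z$. Its Ricci tensor is $\rho^0(X,Y)=-g(R^0(X,e_1)Y,e_1)-g(R^0(X,e_2)Y,e_2)+g(R^0(X,e_3)Y,e_3)$; its symmetrization is $\widetilde\rho^0(X,Y)=\frac12(\rho^0(X,Y)+\rho^0(Y,X))$, and the operator $\widetilde{\mathrm{Ric}}^0$ is defined by $\widetilde\rho^0(X,Y)=g(\widetilde{\mathrm{Ric}}^0(X),Y)$. Second kind algebraic Ricci soliton associated to $\nabla^0$ with constant $c$ means: $\widetilde{\mathrm{Ric}}^0=c\,\mathrm{Id}+D$ where $D$ is a derivation of $\mathfrak{g}$, i.e. a linear map with $D[X,Y]=[DX,Y]+[X,DY]$ for all $X,Y\in\mathfrak{g}$. *)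

(* Defs.v *)
From HB Require Import structures.
From mathcomp Require Import all_boot all_order all_algebra.
From mathcomp Require Import sesquilinear reals.

Set Implicit Arguments.
Unset Strict Implicit.
Unset Printing Implicit Defensive.

Import GRing.Theory.
Local Open Scope ring_scope.

(* V is the Lie algebra of the group; left-invariant vector fields, tensors and
   connections are elements of V and multilinear maps on V. *)
Section LeftInvariantGeometry.
Variables (R : realType) (V : vectType R).
Implicit Types (br nabla : {bilinear V -> V -> V}) (g : {biscalar V}).
Implicit Types (J D Ric : 'End(V)) (conn : V -> V -> V) (e X Y Z : V) (c : R).

Definition lie_bracket br : Prop :=
  (forall X, br X X = 0) /\
  (forall X Y Z, br X (br Y Z) + br Y (br Z X) + br Z (br X Y) = 0).

Definition derivation br D : Prop :=
  forall X Y, D (br X Y) = br (D X) Y + br X (D Y).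

Definition symmetric_metric g : Prop := forall X Y, g X Y = g Y X.

Definition pseudo_orthonormal_basis g e1 e2 e3 : Prop :=
  [/\ basis_of fullv [:: e1; e2; e3],
      [/\ g e1 e1 = 1, g e2 e2 = 1 & g e3 e3 = -1]
    & [/\ g e1 e2 = 0, g e1 e3 = 0 & g e2 e3 = 0]].

(* Metric compatibility has no term X (g (Y, Z)): g is left-invariant, so it is
   constant on pairs of left-invariant fields. *)
Definition levi_civita br g nabla : Prop :=
  (forall X Y, nabla X Y - nabla Y X = br X Y) /\
  (forall X Y Z, g (nabla X Y) Z + g Y (nabla X Z) = 0).

Definition nablaJ nabla J X Y : V := nabla X (J Y) - J (nabla X Y).

Definition canonical_connection nabla J X Y : V :=
  nabla X Y - 2%:R^-1 *: nablaJ nabla J X (J Y).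

Definition curvature br conn X Y Z : V :=
  conn X (conn Y Z) - conn Y (conn X Z) - conn (br X Y) Z.

Definition ricci_tensor br g conn e1 e2 e3 X Y : R :=
  - g (curvature br conn X e1 Y) e1
  - g (curvature br conn X e2 Y) e2
  + g (curvature br conn X e3 Y) e3.

Definition sym_ricci_tensor br g conn e1 e2 e3 X Y : R :=
  2%:R^-1 * (ricci_tensor br g conn e1 e2 e3 X Y
             + ricci_tensor br g conn e1 e2 e3 Y X).

Definition sym_ricci_operator br g conn e1 e2 e3 Ric : Prop :=
  forall X Y, sym_ricci_tensor br g conn e1 e2 e3 X Y = g (Ric X) Y.

Definition second_kind_soliton_with br g conn e1 e2 e3 c D : Prop :=
  derivation br D /\
  exists2 Ric, sym_ricci_operator br g conn e1 e2 e3 Ric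
             & Ric = c *: \1%VF + D.

Definition second_kind_soliton br g conn e1 e2 e3 c : Prop :=
  exists D, second_kind_soliton_with br g conn e1 e2 e3 c D.

End LeftInvariantGeometry.

(* Main.v *)
(* Since nabla^0 is metric, commutes with J and kills the timelike direction, it
   acts on span(e1, e2) through so(2): nabla^0_X Y = theta(X) rot(Y) with
   theta(X) = g(nabla_X e1, e2). As so(2) is abelian, its curvature is just
   - theta([X, Y]) rot, so the Ricci tensor, hence D = Ric - c Id, is explicit in
   terms of A = alpha^2 + beta gamma / 2 and B = (alpha + delta / 2) gamma. The
   e1, e2 components of D[e1, e2] and the e2, e3 components of D[e2, e3] then
   force the two cases. *)
Require Import Defs.
From mathcomp Require Import all_boot all_order all_algebra.
From mathcomp Require Import sesquilinear reals.
From mathcomp Require Import ring lra.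

Import GRing.Theory Num.Theory.

Local Open Scope ring_scope.

(** * Coordinates and linear maps in a pseudo-orthonormal frame *)

Section LorentzianFrame.
Variables (R : realType) (V : vectType R) (g : {biscalar V}) (e1 e2 e3 : V).
Hypotheses (g_sym : symmetric_metric g)
  (e_basis : pseudo_orthonormal_basis g e1 e2 e3).

Let gB X Y Z : g (X - Y) Z = g X Z - g Y Z. Proof. exact: linearBl. Qed.
Let gD X Y Z : g (X + Y) Z = g X Z + g Y Z. Proof. exact: linearDl. Qed.
Let gZ a X Z : g (a *: X) Z = a * g X Z. Proof. exact: linearZl_LR. Qed.
Let gN X Z : g (- X) Z = - g X Z. Proof. exact: linearNl. Qed.
Let g0 Z : g 0 Z = 0. Proof. exact: linear0l. Qed.

Lemma metric_frame :
  [/\ [/\ g e1 e1 = 1, g e1 e2 = 0 & g e1 e3 = 0],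
      [/\ g e2 e1 = 0, g e2 e2 = 1 & g e2 e3 = 0]
    & [/\ g e3 e1 = 0, g e3 e2 = 0 & g e3 e3 = -1]].
Proof.
case: e_basis => _ [g11 g22 g33] [g12 g13 g23].
by split; split=> //; rewrite g_sym.
Qed.

(** The coefficient of [e3] is [- g X e3] because [g e3 e3 = -1]; most signs below come from
    this. *)
Lemma frame_decomposition X :
  X = g X e1 *: e1 + g X e2 *: e2 - g X e3 *: e3.
Proof.
have [[g11 g12 g13] [g21 g22 g23] [g31 g32 g33]] := metric_frame.
have [/andP[/eqP span_e _] _ _] := e_basis.
have : X \in <<[:: e1; e2; e3]>>%VS by rewrite span_e memvf.
rewrite !span_cons span_nil addv0.
case/memv_addP=> _ /vlineP[a ->] [Y /memv_addP[_ /vlineP[b ->]]].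
case=> _ /vlineP[d ->] -> ->.
rewrite !(linearDl, linearZl_LR) /= g11 g12 g13 g21 g22 g23 g31 g32 g33.
by rewrite !(mulr0, mulr1, mulrN1, addr0, add0r) scaleNr opprK addrA.
Qed.

Lemma frame_ext X Y :
  g X e1 = g Y e1 -> g X e2 = g Y e2 -> g X e3 = g Y e3 -> X = Y.
Proof.
move=> E1 E2 E3; rewrite (frame_decomposition X) (frame_decomposition Y).
by rewrite E1 E2 E3.
Qed.

Lemma linear_frame_ext (f h : 'End(V)) :
  f e1 = h e1 -> f e2 = h e2 -> f e3 = h e3 -> f = h.
Proof.
move=> E1 E2 E3; apply/lfunP => X; rewrite (frame_decomposition X).
by rewrite !(linearB, linearD, linearZ) /= E1 E2 E3.
Qed.

Lemma exists_linear_frame (u1 u2 u3 : V) :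
  exists f : 'End(V), [/\ f e1 = u1, f e2 = u2 & f e3 = u3].
Proof.
have [/andP[_ free_e] _ _] := e_basis.
have [f /(_ free_e erefl)[f1 f2 f3]] :=
  linear_of_free [:: e1; e2; e3] [:: u1; u2; u3].
by exists (linfun f); rewrite !lfunE.
Qed.

(** * The canonical connection, its curvature and its Ricci tensor *)

Section CanonicalConnection.
Variables (br nabla : {bilinear V -> V -> V}) (J : 'End(V)).
Hypotheses (J_e : [/\ J e1 = e1, J e2 = e2 & J e3 = - e3])
  (nabla_lc : levi_civita br g nabla).

Lemma koszul X Y Z :
  g (nabla X Y) Z = 2%:R^-1 * (g (br X Y) Z - g (br Y Z) X + g (br Z X) Y).
Proof.
have [torsion compat] := nabla_lc.
rewrite -!torsion !linearBl /=.
(* One instance of compatibility per differentiating field: once the brackets are differences of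
   [nabla] terms, everything else cancels in pairs. *)
have := compat X Y Z; have := compat Y X Z; have := compat Z X Y.
rewrite ![g _ (nabla _ _)]g_sym.
move=> /eqP; rewrite addr_eq0 => /eqP ->.
move=> /eqP; rewrite addr_eq0 => /eqP ->.
move=> /eqP; rewrite addr_eq0 => /eqP ->.
by field.
Qed.

(** The generator of so(2) on the plane of [e1] and [e2], extended by zero to [e3]. *)
Definition rotation Y : V := g Y e1 *: e2 - g Y e2 *: e1.

(** As J squares to the identity, the left side is half of [nabla X Y + J (nabla X (J Y))], the part
    of [nabla X] commuting with [J]. This discards the entries mixing [e3] with the plane; in a skew
    operator only the [e1], [e2] entry theta(X) is left. *)
Lemma canonical_connectionE X Y :
  canonical_connection nabla J X Y = g (nabla X e1) e2 *: rotation Y.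
Proof.
have [[g11 g12 g13] [g21 g22 g23] [g31 g32 g33]] := metric_frame.
have [J1 J2 J3] := J_e; have [_ compat] := nabla_lc.
have skew U W : g (nabla X U) W = - g (nabla X W) U.
  by apply/eqP; rewrite -addr_eq0 [X in _ + X]g_sym compat.
have diag U : g (nabla X U) U = 0.
  by apply/eqP; have /eqP := skew U U; rewrite -addr_eq0 -mulr2n mulrn_eq0.
(* Two signs cancel on [e3]: that of the Lorentzian coordinate and that of [J e3]. *)
have JE Z : J Z = g Z e1 *: e1 + g Z e2 *: e2 + g Z e3 *: e3.
  by rewrite {1}(frame_decomposition Z) !(linearB, linearD, linearZ) /=
             J1 J2 J3 opprK.
have nablaE Z U : g (nabla X Z) U = g Z e1 * g (nabla X e1) U
    + g Z e2 * g (nabla X e2) U - g Z e3 * g (nabla X e3) U.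
  by rewrite {1}(frame_decomposition Z) !(linearBr, linearDr, linearZr_LR)
             !(gB, gD, gZ).
have JJ : J (J Y) = Y.
  by rewrite (JE Y) !(linearD, linearZ) /= J1 J2 J3 scalerN
     -frame_decomposition.
rewrite /canonical_connection /nablaJ /rotation JJ.
apply: frame_ext; rewrite !(gB, gZ) (JE (nabla X (J Y))) !(gD, gZ)
    !(nablaE Y) !(nablaE (J Y)) !JE !(gD, gZ) g11 g12 g13 g21 g22 g23
    g31 g32 g33 !diag (skew e2 e1) (skew e3 e1) (skew e3 e2); by field.
Qed.

Lemma curvature_canonicalE X Y Z :
  curvature br (canonical_connection nabla J) X Y Z
  = - g (nabla (br X Y) e1) e2 *: rotation Z.
Proof.
have rotZ a W : rotation (a *: W) = a *: rotation W.
  by rewrite /rotation !gZ scalerBr !scalerA.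
rewrite /curvature !canonical_connectionE !rotZ !scalerA mulrC subrr.
by rewrite sub0r scaleNr.
Qed.

(** [rotation Y] is orthogonal to [e3], so the timelike term of the trace vanishes. *)
Lemma ricci_canonicalE X Y :
  ricci_tensor br g (canonical_connection nabla J) e1 e2 e3 X Y
  = g Y e1 * g (nabla (br X e2) e1) e2 - g Y e2 * g (nabla (br X e1) e1) e2.
Proof.
have [[g11 g12 g13] [g21 g22 g23] [g31 g32 g33]] := metric_frame.
rewrite /ricci_tensor !curvature_canonicalE /rotation.
rewrite !(gB, gD, gZ) g11 g12 g13 g21 g22 g23.
ring.
Qed.

(** * The Lie algebra of G7: Ricci operator and soliton equations *)

Section LieAlgebraG7.
Variables (alpha beta gamma delta : R).
Hypotheses (lie_br : lie_bracket br)
  (br12 : br e1 e2 = - alpha *: e1 - beta *: e2 - beta *: e3)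
  (br13 : br e1 e3 = alpha *: e1 + beta *: e2 + beta *: e3)
  (br23 : br e2 e3 = gamma *: e1 + delta *: e2 + delta *: e3).

Let brBl X Y Z : br (X - Y) Z = br X Z - br Y Z. Proof. exact: linearBl. Qed.
Let brDl X Y Z : br (X + Y) Z = br X Z + br Y Z. Proof. exact: linearDl. Qed.
Let brZl a X Z : br (a *: X) Z = a *: br X Z. Proof. exact: linearZl_LR. Qed.
Let brBr X Y Z : br Z (X - Y) = br Z X - br Z Y. Proof. exact: linearBr. Qed.
Let brDr X Y Z : br Z (X + Y) = br Z X + br Z Y. Proof. exact: linearDr. Qed.
Let brZr a X Z : br Z (a *: X) = a *: br Z X. Proof. exact: linearZr_LR. Qed.

Lemma bracket_skew X Y : br X Y = - br Y X.
Proof.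
have [brxx _] := lie_br.
by apply/eqP; rewrite -addr_eq0; have /eqP := brxx (X + Y);
   rewrite brDl !brDr !brxx addr0 add0r addrC.
Qed.

Lemma bracket_frame :
  [/\ [/\ br e1 e1 = 0, br e2 e2 = 0 & br e3 e3 = 0],
      br e2 e1 = - br e1 e2, br e3 e1 = - br e1 e3 & br e3 e2 = - br e2 e3].
Proof.
have [brxx _] := lie_br.
by split; first split; rewrite ?brxx // bracket_skew.
Qed.

Lemma bracket_coord X Y : br X Y =
    (g X e1 * g Y e2 - g X e2 * g Y e1) *: br e1 e2
  - (g X e1 * g Y e3 - g X e3 * g Y e1) *: br e1 e3
  - (g X e2 * g Y e3 - g X e3 * g Y e2) *: br e2 e3.
Proof.
have [[b11 b22 b33] b21 b31 b32] := bracket_frame.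
rewrite {1}(frame_decomposition X) {1}(frame_decomposition Y).
rewrite !(brBl, brDl, brZl) !(brBr, brDr, brZr) b11 b22 b33 b21 b31 b32.
apply: frame_ext; rewrite !(gB, gD, gZ, gN, g0); ring.
Qed.

(** The defect of the derivation identity is bilinear and skew in its arguments, so three pairs of
    frame vectors suffice. *)
Lemma derivation_frame (D : 'End(V)) :
  D (br e1 e2) = br (D e1) e2 + br e1 (D e2) ->
  D (br e1 e3) = br (D e1) e3 + br e1 (D e3) ->
  D (br e2 e3) = br (D e2) e3 + br e2 (D e3) ->
  derivation br D.
Proof.
move=> D12 D13 D23 X Y.
have linE a b d u v w :
    D (a *: u + b *: v - d *: w) = a *: D u + b *: D v - d *: D w.
  by rewrite linearB linearD !linearZ.
have DE Z : D Z = g Z e1 *: D e1 + g Z e2 *: D e2 - g Z e3 *: D e3.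
  by rewrite {1}(frame_decomposition Z) linE.
have brl Z W :
    br Z W = g Z e1 *: br e1 W + g Z e2 *: br e2 W - g Z e3 *: br e3 W.
  by rewrite {1}(frame_decomposition Z) brBl brDl !brZl.
have brr Z W :
    br W Z = g Z e1 *: br W e1 + g Z e2 *: br W e2 - g Z e3 *: br W e3.
  by rewrite {1}(frame_decomposition Z) brBr brDr !brZr.
rewrite (bracket_coord X Y) -scaleNr linE D12 D13 D23.
rewrite (DE X) (DE Y) brBl brDl !brZl brBr brDr !brZr.
rewrite !(brl X) !(brr Y) !(bracket_skew (D _)).
apply: frame_ext; rewrite !(gB, gD, gZ, gN); ring.
Qed.

Lemma connection_form_G7 X :
  g (nabla X e1) e2
  = alpha * g X e1 + beta * g X e2 - (gamma / 2%:R - beta) * g X e3.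
Proof.
have [[g11 g12 g13] [g21 g22 g23] [g31 g32 g33]] := metric_frame.
have [[b11 b22 b33] b21 b31 b32] := bracket_frame.
rewrite {1}(frame_decomposition X) !(linearBl, linearDl, linearZl_LR) /=.
rewrite !koszul b11 b22 b21 b31 br12 br13 br23.
rewrite !(gB, gD, gZ, gN, g0) g11 g12 g13 g21 g22 g23 g31 g32 g33.
by field.
Qed.

(** [A] and [B] are values of theta on brackets: theta([e1, e2]) = -A, theta([e1, e3]) = A and
    theta([e2, e3]) = B, where the terms in beta^2 and beta delta cancel. *)
Lemma sym_ricci_G7 X Y (A := alpha ^+ 2 + beta * gamma / 2%:R)
    (B := (alpha + delta / 2%:R) * gamma) :
  sym_ricci_tensor br g (canonical_connection nabla J) e1 e2 e3 X Y
  = - A * (g X e1 * g Y e1 + g X e2 * g Y e2)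
    + B / 2%:R * (g X e1 * g Y e3 + g X e3 * g Y e1)
    - A / 2%:R * (g X e2 * g Y e3 + g X e3 * g Y e2).
Proof.
have [[g11 g12 g13] [g21 g22 g23] [g31 g32 g33]] := metric_frame.
have form1 Z : g (nabla (br Z e1) e1) e2 = A * (g Z e2 + g Z e3).
  rewrite connection_form_G7 (bracket_coord Z e1) g11 g12 g13 br12 br13 br23.
  rewrite !(gB, gD, gZ) g11 g12 g13 g21 g22 g23 g31 g32 g33 /A.
  by field.
have form2 Z : g (nabla (br Z e2) e1) e2 = B * g Z e3 - A * g Z e1.
  rewrite connection_form_G7 (bracket_coord Z e2) g21 g22 g23 br12 br13 br23.
  rewrite !(gB, gD, gZ) g11 g12 g13 g21 g22 g23 g31 g32 g33 /A /B.
  by field.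
rewrite /sym_ricci_tensor !ricci_canonicalE !form1 !form2.
by field.
Qed.

(** Raising an index flips the sign of [e3] components, hence the opposite off-diagonal entries of
    this self-adjoint operator. *)
Lemma sym_ricci_operator_G7 (Ric : 'End(V))
    (A := alpha ^+ 2 + beta * gamma / 2%:R)
    (B := (alpha + delta / 2%:R) * gamma) :
  sym_ricci_operator br g (canonical_connection nabla J) e1 e2 e3 Ric <->
  [/\ Ric e1 = - A *: e1 + (B / 2%:R) *: e3,
      Ric e2 = - A *: e2 - (A / 2%:R) *: e3
    & Ric e3 = - (B / 2%:R) *: e1 + (A / 2%:R) *: e2].
Proof.
have [[g11 g12 g13] [g21 g22 g23] [g31 g32 g33]] := metric_frame.
split=> [RicE | [Ric1 Ric2 Ric3] X Y].
  split; apply: frame_ext; rewrite -RicE sym_ricci_G7 -/A -/B !(gB, gD, gZ);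
    rewrite ?(g11, g12, g13, g21, g22, g23, g31, g32, g33); by field.
rewrite sym_ricci_G7 -/A -/B [in RHS](frame_decomposition X).
rewrite !(linearB, linearD, linearZ) /= Ric1 Ric2 Ric3.
rewrite !(gB, gD, gZ, gN) !(g_sym _ Y).
by field.
Qed.

(** The soliton equation determines [D], so only whether one explicit map is a derivation remains
    open. *)
Lemma soliton_operator_G7 c (D : 'End(V))
    (A := alpha ^+ 2 + beta * gamma / 2%:R)
    (B := (alpha + delta / 2%:R) * gamma) :
  second_kind_soliton_with br g (canonical_connection nabla J) e1 e2 e3 c D <->
  derivation br D /\
  [/\ D e1 = - (A + c) *: e1 + (B / 2%:R) *: e3,
      D e2 = - (A + c) *: e2 - (A / 2%:R) *: e3
    & D e3 = - (B / 2%:R) *: e1 + (A / 2%:R) *: e2 - c *: e3].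
Proof.
have addE X : (c *: \1%VF + D) X = c *: X + D X.
  by rewrite add_lfunE scale_lfunE id_lfunE.
rewrite /second_kind_soliton_with; split=> -[derD].
  case=> Ric /sym_ricci_operator_G7[Ric1 Ric2 Ric3] RicE.
  have DE X : D X = Ric X - c *: X by rewrite RicE addE addrC addKr.
  split=> //; rewrite !DE Ric1 Ric2 Ric3.
  by split; apply: frame_ext; rewrite !(gB, gD, gZ) /A /B; ring.
case=> D1 D2 D3; split=> //; exists (c *: \1%VF + D) => //.
apply/sym_ricci_operator_G7; rewrite !addE D1 D2 D3.
by split; apply: frame_ext; rewrite !(gB, gD, gZ) /A /B; ring.
Qed.

Lemma soliton_necessary_G7 c (D : 'End(V)) :
  alpha + delta != 0 -> alpha * gamma = 0 ->
  second_kind_soliton_with br g (canonical_connection nabla J) e1 e2 e3 c D ->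
  [/\ alpha = 0, gamma = 0 & c = 0] \/
  [/\ alpha != 0, beta = 0, gamma = 0 & alpha ^+ 2 / 2%:R + c = 0].
Proof.
move=> adn0 ag0 /soliton_operator_G7[derD [D1 D2 D3]].
have [[g11 g12 g13] [g21 g22 g23] [g31 g32 g33]] := metric_frame.
have [[b11 b22 b33] b21 b31 b32] := bracket_frame.
set A := alpha ^+ 2 + _ in D1 D2 D3; set B := (alpha + _) * _ in D1 D2 D3.
have linE a b d u v w :
    D (a *: u + b *: v + d *: w) = a *: D u + b *: D v + d *: D w.
  by rewrite !linearD !linearZ.
pose bilE := (brBl, brDl, brZl, brBr, brDr, brZr, b11, b22, b33, b21, b31, b32).
pose gE := (gB, gD, gZ, gN, g0, g11, g12, g13, g21, g22, g23, g31, g32, g33).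
have H12 := derD e1 e2.
have H23 := derD e2 e3.
rewrite br12 -!scaleNr linE D1 D2 D3 !bilE ?(br12, br13, br23) in H12.
rewrite br23 linE D1 D2 D3 !bilE ?(br12, br13, br23) in H23.
have /= := congr1 (g^~ e1) H12; rewrite !gE => E121.
have /= := congr1 (g^~ e2) H12; rewrite !gE => E122.
have /= := congr1 (g^~ e2) H23; rewrite !gE => E232.
have /= := congr1 (g^~ e3) H23; rewrite !gE => E233.
have [a0|an0] := eqVneq alpha 0.
  have dn0 : delta != 0 by move: adn0; rewrite a0 add0r.
  have mul_delta0 x : delta * x = 0 -> x = 0.
    by move=> /eqP; rewrite mulf_eq0 (negbTE dn0) => /eqP.
  rewrite /A /B a0 in E232 E233.
  (* The [e2] and [e3] coefficients of [D (br e2 e3)] differ by gamma B / 2, while those of the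
     other side coincide. Hence gamma B = 0, which for alpha = 0 reads delta gamma^2 / 2 = 0. *)
  have gamma0 : gamma = 0.
    by apply/eqP; rewrite -sqrf_eq0; apply/eqP/mul_delta0; lra.
  rewrite gamma0 in E232; left; split=> //.
  by apply: mul_delta0; lra.
have mul_alpha0 x : alpha * x = 0 -> x = 0.
  by move=> /eqP; rewrite mulf_eq0 (negbTE an0) => /eqP.
have gamma0 := mul_alpha0 _ ag0.
rewrite /A /B gamma0 in E121 E122.
(* Now A = alpha^2 and B = 0, so [E121] reduces to alpha (A / 2 + c) = 0. *)
have c_eq : alpha ^+ 2 / 2%:R + c = 0 by apply: mul_alpha0; lra.
have c_val : c = - (alpha ^+ 2 / 2%:R) by lra.
rewrite c_val in E122.
right; split=> //.
(* [E122] is now beta (A + c) = 0 with A + c = alpha^2 / 2, so alpha is cancelled twice. *)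
by apply/mul_alpha0/mul_alpha0; lra.
Qed.

Lemma soliton_sufficient_G7 c :
  [/\ alpha = 0, gamma = 0 & c = 0] \/
  [/\ beta = 0, gamma = 0 & alpha ^+ 2 / 2%:R + c = 0] ->
  second_kind_soliton br g (canonical_connection nabla J) e1 e2 e3 c.
Proof.
have [[b11 b22 b33] b21 b31 b32] := bracket_frame.
pose bilE := (brBl, brDl, brZl, brBr, brDr, brZr, b11, b22, b33, b21, b31, b32).
case=> [[a0 gamma0 c0] | [b0 gamma0 c_eq]].
  (* Here A, B and c all vanish, hence so does [D]. *)
  exists 0; apply/soliton_operator_G7; split=> [X Y|].
    by rewrite !lfunE !(linear0l, linear0r) addr0.
  rewrite !lfunE /= a0 gamma0 c0.
  by split; apply: frame_ext; rewrite !(gB, gD, gZ, g0); ring.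
have {c_eq}-> : c = - (alpha ^+ 2 / 2%:R) by lra.
set k := alpha ^+ 2 / 2%:R.
(* The witness is the operator forced by [soliton_operator_G7], with A = 2k, B = 0 and c = -k. *)
have [D [D1 D2 D3]] :=
  exists_linear_frame (- k *: e1) (- k *: e2 - k *: e3) (k *: e2 + k *: e3).
have linE a b d u v w :
    D (a *: u + b *: v + d *: w) = a *: D u + b *: D v + d *: D w.
  by rewrite !linearD !linearZ.
exists D; apply/soliton_operator_G7; split.
  by apply: derivation_frame; rewrite ?br12 ?br13 ?br23 -?scaleNr linE D1 D2 D3
    !bilE ?(br12, br13, br23) ?(b0, gamma0); apply: frame_ext;
    rewrite !(gB, gD, gZ, gN, g0); ring.
rewrite D1 D2 D3 /k b0 gamma0.
by split; apply: frame_ext; rewrite !(gB, gD, gZ); field.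
Qed.

End LieAlgebraG7.
End CanonicalConnection.
End LorentzianFrame.

Theorem theorem3p23 (R : realType) (V : vectType R)
    (br : {bilinear V -> V -> V}) (g : {biscalar V}) (J : 'End(V))
    (nabla : {bilinear V -> V -> V}) (e1 e2 e3 : V)
    (alpha beta gamma delta c : R)
    (lie_br : lie_bracket br)
    (alphaDdelta_neq0 : alpha + delta != 0)
    (alphaMgamma_eq0 : alpha * gamma = 0)
    (g_sym : symmetric_metric g)
    (e_basis : pseudo_orthonormal_basis g e1 e2 e3)
    (br12 : br e1 e2 = - alpha *: e1 - beta *: e2 - beta *: e3)
    (br13 : br e1 e3 = alpha *: e1 + beta *: e2 + beta *: e3)
    (br23 : br e2 e3 = gamma *: e1 + delta *: e2 + delta *: e3)
    (J_e : [/\ J e1 = e1, J e2 = e2 & J e3 = - e3])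
    (nabla_lc : levi_civita br g nabla) :
  let nabla0 := canonical_connection nabla J in
  let case_i := [/\ alpha = 0, gamma = 0, c = 0 & delta != 0] in
  let case_ii := [/\ alpha != 0, beta = 0 /\ gamma = 0,
                     alpha ^+ 2 / 2%:R + c = 0 & alpha + delta != 0] in
  (second_kind_soliton br g nabla0 e1 e2 e3 c <-> case_i \/ case_ii)
  /\ forall D : 'End(V), second_kind_soliton_with br g nabla0 e1 e2 e3 c D ->
     (case_i -> D = 0)
     /\ (case_ii ->
         [/\ D e1 = - (alpha ^+ 2 / 2%:R) *: e1,
             D e2 = - (alpha ^+ 2 / 2%:R) *: e2 - (alpha ^+ 2 / 2%:R) *: e3
           & D e3 = (alpha ^+ 2 / 2%:R) *: e2 + (alpha ^+ 2 / 2%:R) *: e3]).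
Proof.
move=> nabla0 case_i case_ii.
have necessary := soliton_necessary_G7 _ _ _ _ _ _ g_sym e_basis
    _ _ _ J_e nabla_lc _ _ _ _ lie_br br12 br13 br23.
have sufficient := soliton_sufficient_G7 _ _ _ _ _ _ g_sym e_basis
    _ _ _ J_e nabla_lc _ _ _ _ lie_br br12 br13 br23.
have operatorE := soliton_operator_G7 _ _ _ _ _ _ g_sym e_basis
    _ _ _ J_e nabla_lc _ _ _ _ lie_br br12 br13 br23.
have ext := frame_ext _ _ _ _ _ _ g_sym e_basis.
split; first split.
- case=> D /(necessary _ _ alphaDdelta_neq0 alphaMgamma_eq0).
  case=> [[a0 gamma0 c0] | [an0 b0 gamma0 c_eq]]; [left | right]; split=> //.
  (* Since alpha = 0, [delta] is [alpha + delta], nonzero by hypothesis. *)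
  by rewrite -[delta]add0r -[X in X + _]a0.
- move=> cases; apply: sufficient.
  by case: cases => [[? ? ? _] | [_ [? ?] ? _]]; [left | right].
(* [D] is determined by [operatorE], so its values follow by substituting the parameters of each
   case. *)
move=> D /operatorE[_ [D1 D2 D3]]; split.
  case=> a0 gamma0 c0 _.
  rewrite a0 gamma0 c0 in D1 D2 D3.
  apply: (linear_frame_ext _ _ _ _ _ _ g_sym e_basis);
    rewrite lfunE /= ?(D1, D2, D3);
    apply: ext; rewrite !(linearBl, linearDl, linearZl_LR, linear0l) /=; ring.
case=> _ [b0 gamma0] c_eq _.
have c_val : c = - (alpha ^+ 2 / 2%:R) by lra.
rewrite b0 gamma0 c_val in D1 D2 D3; rewrite D1 D2 D3.
by split; apply: ext; rewrite !(linearBl, linearDl, linearZl_LR) /=; field.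
Qed.
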